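(* Let $P\subset\mathbb{Z}^n$ be a polymatroid. Let $S^{\mathrm{up}}(P):=P+\mathbb{Z}_{\ge0}^n$ and $S^{\mathrm{low}}(P):=P+\mathbb{Z}_{\le0}^n$ be the upper and lower shadows of $P$. The polymatroid Tutte polynomial $\mathscr{T}_P(x,y)$ satisfies (and is uniquely determined by any one of) the following two formulas: $$\mathscr{T}_P\!\left(x,\frac{1}{1-v}\right)=\sum_{\mathbf a\in S^{\mathrm{up}}(P)}x^{|\widetilde{\mathrm{Int}}(\mathbf a)|}\,v^{\mathrm{level}(\mathbf a)-\mathrm{level}(P)},$$ $$\mathscr{T}_P\!\left(\frac{1}{1-u},y\right)=\sum_{\mathbf a\in S^{\mathrm{low}}(P)}u^{\mathrm{level}(P)-\mathrm{level}(\mathbf a)}\,y^{|\widetilde{\mathrm{Ext}}(\mathbf a)|},$$ as identities of formal power series in $v$ (resp. $u$) with coefficients polynomial in $x$ (resp. $y$), where $\widetilde{\mathrm{Int}}(\mathbf a)$ is taken with respect to $S^{\mathrm{up}}(P)$ and $\widetilde{\mathrm{Ext}}(\mathbf a)$ with respect to $S^{\mathrm{low}}(P)$.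
   Context: Notation: $[n]=\{1,\dots,n\}$; $\mathbf e_1,\dots,\mathbf e_n$ is the canonical basis of $\mathbb{R}^n$, and $\mathbf e_0=0$; sums of sets are Minkowski sums. A polymatroid in $\mathbb{Z}^n$ is a finite nonempty set $P\subset\mathbb{Z}^n$ satisfying the Exchange Axiom: for any $\mathbf a,\mathbf b\in P$ and any $i\in[n]$ with $a_i>b_i$, there exists $j\in[n]$ such that $a_j<b_j$ and both $\mathbf a-\mathbf e_i+\mathbf e_j$ and $\mathbf b+\mathbf e_i-\mathbf e_j$ belong to $P$. For $\mathbf a\in\mathbb{Z}^n$, $\mathrm{level}(\mathbf a)=a_1+\dots+a_n$; all elements of $P$ have the same level, denoted $\mathrm{level}(P)$. For $\mathbf a\in P$, an index $i\in[n]$ is internally active if there is no $j\in[n]$, $j<i$, with $\mathbf a-\mathbf e_i+\mathbf e_j\in P$, and externally active if there is no $j\in[n]$, $j<i$, with $\mathbf a+\mathbf e_i-\mathbf e_j\in P$. Let $\mathrm{Int}(\mathbf a),\mathrm{Ext}(\mathbf a)\subseteq[n]$ be the sets of such indices. The polymatroid Tutte polynomial is $$\mathscr{T}_P(x,y)=\sum_{\mathbf a\in P}x^{|\mathrm{Int}(\mathbf a)\setminus\mathrm{Ext}(\mathbf a)|}\,y^{|\mathrm{Ext}(\mathbf a)\setminus\mathrm{Int}(\mathbf a)|}\,(x+y-1)^{|\mathrm{Int}(\mathbf a)\cap\mathrm{Ext}(\mathbf a)|}.$$ Let $S$ be an upper or lower shadow and $\mathbf a\in S$. An index $i\in[n]$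 belongs to $\widetilde{\mathrm{Int}}(\mathbf a)=\widetilde{\mathrm{Int}}_S(\mathbf a)$ if there is no $j\in\{0,1,\dots,i-1\}$ such that $\mathbf a-\mathbf e_i+\mathbf e_j\in S$. It belongs to $\widetilde{\mathrm{Ext}}(\mathbf a)=\widetilde{\mathrm{Ext}}_S(\mathbf a)$ if there is no $j\in\{0,1,\dots,i-1\}$ such that $\mathbf a+\mathbf e_i-\mathbf e_j\in S$. *)

(* Defs.v *)
From HB Require Import structures.
From mathcomp Require Import all_boot all_order all_algebra.
From mathcomp Require Import finmap zify.
From mathcomp Require Import boolp classical_sets functions cardinality fsbigop.

Set Implicit Arguments.
Unset Strict Implicit.
Unset Printing Implicit Defensive.

Import Order.TTheory GRing.Theory Num.Theory.

Local Open Scope classical_set_scope.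
Local Open Scope ring_scope.

Record fps (R : Type) := Fps { coef_fps :> nat -> R }.
Arguments Fps {R}.

HB.instance Definition _ (R : Type) := [isNew for @coef_fps R].
HB.instance Definition _ (R : choiceType) := [Choice of fps R by <:].

Lemma fpsP (R : Type) (f g : fps R) : (forall k, f k = g k) -> f = g.
Proof. by case: f g => [f] [g] /= /funext ->. Qed.

Section FpsRing.
Variable R : comNzRingType.
Implicit Types f g h : fps R.

Definition fps_zero : fps R := Fps (fun=> 0).
Definition fps_opp f : fps R := Fps (fun k => - f k).
Definition fps_add f g : fps R := Fps (fun k => f k + g k).

Fact fps_addA : associative fps_add.
Proof. by move=> f g h; apply: fpsP => k /=; rewrite addrA. Qed.
Fact fps_addC : commutative fps_add.
Proof. by move=> f g; apply: fpsP => k /=; rewrite addrC. Qed.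
Fact fps_add0 : left_id fps_zero fps_add.
Proof. by move=> f; apply: fpsP => k /=; rewrite add0r. Qed.
Fact fps_addN : left_inverse fps_zero fps_opp fps_add.
Proof. by move=> f; apply: fpsP => k /=; rewrite addNr. Qed.

HB.instance Definition _ :=
  GRing.isZmodule.Build (fps R) fps_addA fps_addC fps_add0 fps_addN.

Definition fpsC (c : R) : fps R := Fps (fun k => if k == 0%N then c else 0).
Definition fpsX : fps R := Fps (fun k => (k == 1%N)%:R).

Definition fps_mul f g : fps R :=
  Fps (fun k => \sum_(i < k.+1) f i * g (k - i)%N).

Let trunc N f : {poly R} := \poly_(i < N) f i.

Let fps_mul_trunc N f g k : (k < N)%N ->
  fps_mul f g k = (trunc N f * trunc N g)`_k.
Proof.
move=> kN; rewrite coefM /=; apply: eq_bigr => i _.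
rewrite !coef_poly (leq_ltn_trans (leq_subr _ _) kN).
by rewrite (leq_ltn_trans _ kN) // -ltnS.
Qed.

Fact fps_mulC : commutative fps_mul.
Proof.
by move=> f g; apply: fpsP => k; rewrite !(@fps_mul_trunc k.+1) // mulrC.
Qed.

Fact fps_mulA : associative fps_mul.
Proof.
move=> f g h; apply: fpsP => k.
have fE (u : fps R) i : (i <= k)%N -> u i = (trunc k.+1 u)`_i.
  by move=> ik; rewrite coef_poly ltnS ik.
transitivity (trunc k.+1 f * (trunc k.+1 g * trunc k.+1 h))`_k.
  rewrite coefM; apply: eq_bigr => i _.
  by rewrite (fE f) ?leq_ord // (@fps_mul_trunc k.+1) // ltnS leq_subr.
rewrite mulrA coefM; apply: eq_bigr => i _.
by rewrite (fE h) ?leq_subr // (@fps_mul_trunc k.+1).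
Qed.

Fact fps_mul1 : left_id (fpsC 1) fps_mul.
Proof.
move=> f; apply: fpsP => k /=; rewrite big_ord_recl /= mul1r subn0.
by rewrite big1 ?addr0 // => i _; rewrite mul0r.
Qed.

Fact fps_mulD : left_distributive fps_mul fps_add.
Proof.
move=> f g h; apply: fpsP => k /=; rewrite -big_split /=.
by apply: eq_bigr => i _; rewrite mulrDl.
Qed.

Fact fps_1neq0 : fpsC 1 != 0.
Proof.
by apply/eqP => /(congr1 (fun f : fps R => f 0%N)) /= /eqP; rewrite oner_eq0.
Qed.

HB.instance Definition _ := GRing.Zmodule_isComNzRing.Build (fps R)
  fps_mulA fps_mulC fps_mul1 fps_mulD fps_1neq0.

Definition fps_unit : {pred fps R} := fun f => `[< exists g, g * f = 1 >].
Definition fps_inv f : fps R :=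
  if pselect (exists g, g * f = 1) is left fU then sval (cid fU) else f.

Fact fps_mulV : {in fps_unit, left_inverse 1 fps_inv *%R}.
Proof.
move=> f /asboolP fU; rewrite /fps_inv; case: pselect => // fU'.
by case: (cid fU').
Qed.
Fact fps_unitP f g : g * f = 1 -> fps_unit f.
Proof. by move=> gf; apply/asboolP; exists g. Qed.
Fact fps_inv_out : {in [predC fps_unit], fps_inv =1 id}.
Proof.
by move=> f /asboolP fU; rewrite /fps_inv; case: pselect.
Qed.

HB.instance Definition _ := GRing.ComNzRing_hasMulInverse.Build (fps R)
  fps_mulV fps_unitP fps_inv_out.

Lemma coef_fpsD f g k : (f + g) k = f k + g k. Proof. by []. Qed.
Lemma coef_fpsN f k : (- f) k = - f k. Proof. by []. Qed.
Lemma coef_fpsM f g k : (f * g) k = \sum_(i < k.+1) f i * g (k - i)%N.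
Proof. by []. Qed.
Lemma coef_fps1 k : (1 : fps R) k = (k == 0%N)%:R.
Proof. by rewrite /= ; case: (k == 0%N). Qed.

Lemma fps_geomK : Fps (fun=> 1) * (1 - fpsX) = 1 :> fps R.
Proof.
have E k : (1 - fpsX : fps R) k = (k == 0%N)%:R - (k == 1%N)%:R.
  by rewrite coef_fpsD coef_fpsN coef_fps1.
apply: fpsP => k; rewrite coef_fpsM coef_fps1.
under eq_bigr => i _ do rewrite mul1r E.
case: k => [|k]; first by rewrite big_ord1 subr0.
rewrite !big_ord_recr /= big1 => [|i _].
  by rewrite subSnn subnn sub0r subr0 add0r addNr.
by rewrite /= subSn ?(ltnW (ltn_ord i)) // eqSS subn_eq0 leqNgt ltn_ord subr0.
Qed.

Lemma unit_fps1BX : (1 - fpsX : fps R) \is a GRing.unit.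
Proof. exact: fps_unitP fps_geomK. Qed.

Lemma coef_fps1BXV k : ((1 - fpsX)^-1 : fps R) k = 1.
Proof.
have -> // : (1 - fpsX)^-1 = Fps (fun=> 1) :> fps R.
by apply: (mulIr unit_fps1BX); rewrite mulVr ?unit_fps1BX // fps_geomK.
Qed.

End FpsRing.
Arguments fpsX {R}.

(* Coefficientwise summability is part of the assertion: a sum [\sum_(a \in S)]
   of infinite support would have the default value 0. *)
Definition fps_has_sum (R : comNzRingType) (T : choiceType) (S : set T)
    (F : T -> fps R) (s : fps R) : Prop :=
  forall k, finite_set [set a | S a /\ F a k != 0]
            /\ s k = \sum_(a \in S) F a k.

(* In [{poly {poly int}}] the outer variable ['X] is x and the inner one,
   ['X%:P], is y. *)
Definition eval2 (A : comNzRingType) (p : {poly {poly int}}) (x y : A) : A :=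
  (map_poly (fun q : {poly int} => (map_poly intr q).[y]) p).[x].

(* [evec n 0] is the zero vector, and [evec n k] for 1 <= k <= n is the
   k-th canonical basis vector; an index i of {1, ..., n} is represented by
   an ordinal of ['I_n] of value i - 1. *)
Definition evec (n k : nat) : 'rV[int]_n := \row_(i < n) (i.+1 == k)%:R.

Definition level (n : nat) (a : 'rV[int]_n) : int := \sum_(i < n) a 0 i.

Definition polymatroid (n : nat) (P : {fset 'rV[int]_n}) : Prop :=
  P != fset0 /\
  forall a b : 'rV[int]_n, a \in P -> b \in P ->
  forall i : 'I_n, b 0 i < a 0 i ->
  exists j : 'I_n, [/\ a 0 j < b 0 j,
    a - evec n i.+1 + evec n j.+1 \in P &
    b + evec n i.+1 - evec n j.+1 \in P].

(* The level of an arbitrary element of P; see [polymatroid_level]. *)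
Definition plevel (n : nat) (P : {fset 'rV[int]_n}) : int :=
  level (head 0 (enum_fset P)).

Section Activities.
Variables (n : nat) (P : {fset 'rV[int]_n}).

Definition Int (a : 'rV[int]_n) : {set 'I_n} :=
  [set i : 'I_n | ~~ [exists j : 'I_n, (j < i)%N
                        && (a - evec n i.+1 + evec n j.+1 \in P)]].

Definition Ext (a : 'rV[int]_n) : {set 'I_n} :=
  [set i : 'I_n | ~~ [exists j : 'I_n, (j < i)%N
                        && (a + evec n i.+1 - evec n j.+1 \in P)]].

Definition tutte : {poly {poly int}} :=
  let x := 'X in let y := 'X%:P in
  \sum_(a <- P) x ^+ #|Int a :\: Ext a| * y ^+ #|Ext a :\: Int a|
                * (x + y - 1) ^+ #|Int a :&: Ext a|.

Definition upper_shadow : set 'rV[int]_n :=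
  [set a + z | a in [set` P] & z in [set z : 'rV[int]_n | forall i, 0 <= z 0 i]].

Definition lower_shadow : set 'rV[int]_n :=
  [set a + z | a in [set` P] & z in [set z : 'rV[int]_n | forall i, z 0 i <= 0]].

End Activities.

(* Here j : 'I_i.+1 ranges over {0, ..., i}, i.e. over the numbers strictly
   below the index i + 1 represented by i; j = 0 gives the zero vector. *)
Definition tInt (n : nat) (S : set 'rV[int]_n) (a : 'rV[int]_n) : {set 'I_n} :=
  [set i : 'I_n | ~~ [exists j : 'I_i.+1, a - evec n i.+1 + evec n j \in S]].

Definition tExt (n : nat) (S : set 'rV[int]_n) (a : 'rV[int]_n) : {set 'I_n} :=
  [set i : 'I_n | ~~ [exists j : 'I_i.+1, a + evec n i.+1 - evec n j \in S]].

Lemma level_evec (n : nat) (i : 'I_n) : level (evec n i.+1) = 1.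
Proof.
rewrite /level (bigD1 i) //= mxE eqxx big1 ?addr0 // => j ji.
by rewrite mxE eqSS (_ : _ == _ = false) //; apply: negbTE.
Qed.

Lemma levelD (n : nat) (a b : 'rV[int]_n) : level (a + b) = level a + level b.
Proof. by rewrite /level -big_split; apply: eq_bigr => i _; rewrite mxE. Qed.

Lemma levelN (n : nat) (a : 'rV[int]_n) : level (- a) = - level a.
Proof. by rewrite /level -sumrN; apply: eq_bigr => i _; rewrite mxE. Qed.

Lemma polymatroid_level_eq (n : nat) (P : {fset 'rV[int]_n}) :
  polymatroid P -> {in P &, forall a b, level a = level b}.
Proof.
case=> _ exch a b aP bP.
pose dist (u v : 'rV[int]_n) := (\sum_(i < n) absz (u 0%R i - v 0%R i)%R)%N.
have IH m : forall u v, u \in P -> v \in P -> (dist u v <= m)%N ->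
    (exists i, v 0 i < u 0 i) -> level u = level v.
  elim: m => [|m IH] u v uP vP duv [i vui].
    move: duv; rewrite /dist (bigD1 i) //= leqn0 addn_eq0 absz_eq0 subr_eq0.
    by rewrite gt_eqF.
  have [j [uvj u'P _]] := exch u v uP vP i vui.
  pose u' := u - evec n i.+1 + evec n j.+1.
  have ij : i != j by apply: contraTneq uvj => <-; rewrite -leNgt ltW.
  have <- : level u' = level u.
    by rewrite !levelD levelN !level_evec subrK.
  have u'E k : u' 0 k = u 0 k - (k == i)%:R + (k == j)%:R.
    by rewrite !mxE !eqSS.
  have dlt : (dist u' v < dist u v)%N.
    rewrite /dist (bigD1 i) //= [ltnRHS](bigD1 i) //= -addSn leq_add //.
      rewrite u'E eqxx (negbTE ij) addr0 mulr1n.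
      by move: (u 0 i) (v 0 i) vui => p q; lia.
    apply: leq_sum => k ki; rewrite u'E (negbTE ki) subr0.
    case: eqVneq => [->|_]; rewrite ?addr0 ?mulr1n //.
    by move: (u 0 j) (v 0 j) uvj => p q; lia.
  have [[k vk]|/forallNP nk] := pselect (exists k, v 0 k < u' 0 k).
    by apply: IH => //; [rewrite -ltnS (leq_trans dlt)|exists k].
  have [[k vk]|/forallNP nk'] := pselect (exists k, u' 0 k < v 0 k).
    by have [l [/nk]] := exch v u' vP u'P k vk.
  congr level; apply/rowP => k; apply/eqP; rewrite eq_le !leNgt.
  by apply/andP; split; apply/negP.
have [h|/forallNP nk] := pselect (exists i, b 0 i < a 0 i).
  exact: (IH (dist a b)).
have [h|/forallNP nk'] := pselect (exists i, a 0 i < b 0 i).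
  by rewrite (IH (dist b a) b a).
congr level; apply/rowP => k; apply/eqP; rewrite eq_le !leNgt.
by apply/andP; split; apply/negP.
Qed.

Lemma polymatroid_level (n : nat) (P : {fset 'rV[int]_n}) :
  polymatroid P -> {in P, forall a, level a = plevel P}.
Proof.
move=> hP a aP; apply: (polymatroid_level_eq hP) => //.
rewrite -[_ \in P]/(_ \in enum_fset P); move: aP.
by rewrite -[_ \in P]/(_ \in enum_fset P); case: enum_fset => //= b s _;
  rewrite mem_head.
Qed.

(* The exponents |level a - level P| and |level P - level a| used with the
   shadows are therefore the signed differences themselves. *)
Lemma upper_shadow_level (n : nat) (P : {fset 'rV[int]_n}) :
  polymatroid P -> forall a, upper_shadow P a -> plevel P <= level a.
Proof.
move=> hP _ [a aP [z z0 <-]].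
by rewrite levelD -(polymatroid_level hP aP) lerDl sumr_ge0.
Qed.

Lemma lower_shadow_level (n : nat) (P : {fset 'rV[int]_n}) :
  polymatroid P -> forall a, lower_shadow P a -> level a <= plevel P.
Proof.
move=> hP _ [a aP [z z0 <-]].
by rewrite levelD -(polymatroid_level hP aP) gerDl sumr_le0.
Qed.

(* Main.v *)
From HB Require Import structures.
Require Import Defs.
From mathcomp Require Import all_boot all_order all_algebra.
From mathcomp Require Import finmap.
From mathcomp Require Import boolp classical_sets functions cardinality fsbigop.
From mathcomp Require Import zify.

Set Implicit Arguments.
Unset Strict Implicit.
Unset Printing Implicit Defensive.

Import Order.TTheory GRing.Theory Num.Theory.

Local Open Scope ring_scope.

(** The upper shadow is tiled by the orthants a + N^{Ext(a)}, a in P.  Given b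
    in the shadow, the tile of b is the one at the lexicographically smallest
    a <= b in P: if b_i > a_i for some i that is not externally active, then
    a + e_i - e_j is in P for some j < i, lies below b, and is smaller
    ([anchor_exists]); conversely, two candidates for the same b would differ
    first at some j, and the exchange axiom at j would contradict the external
    activity of an index beyond j ([anchor_unique]).  On the tile of a the set
    tInt is explicit: tInt(b) = {i in Int(a) : b_i = a_i}, again by one exchange
    ([tInt_anchor]).

    So the sum over the tile of a factors over the coordinates.  A coordinate in
    Int(a) only contributes x, one in Ext(a) only contributes
    1 + v + v^2 + ... = y, one in both contributes
    x + v + v^2 + ... = x + y - 1, and one in neither contributes 1.  These are
    the factors of the term of a in the Tutte polynomial at y = 1/(1-v)
    ([coef_activity], [upper_expansion]).

    The map a |-> - a sends P to a polymatroid, exchanges Int with Ext and the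
    upper shadow with the lower one, so that the second formula is the first one
    for -P ([lower_expansion]).

    Uniqueness holds because 1/(1-v) = 1 + t with t = v + v^2 + ..., and a
    polynomial p with p(1 + t) = 0 vanishes: the lowest coefficient of p(1 + T)
    would survive as the coefficient of the same power of v
    ([fps_horner_geom_inj]). *)

(** * The tiling of the upper shadow by orthants *)

Lemma evecE n (i k : 'I_n) : evec n i.+1 0 k = (k == i)%:R.
Proof. by rewrite mxE eqSS. Qed.

Lemma evec0 n : evec n 0 = 0.
Proof. by apply/rowP => k; rewrite !mxE. Qed.

Lemma upper_shadowP n (P : {fset 'rV[int]_n}) (b : 'rV[int]_n) :
  upper_shadow P b <-> exists2 a, a \in P & forall i, a 0 i <= b 0 i.
Proof.
split=> [[a aP [z z0 <-]]|[a aP ab]].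
  by exists a => // i; rewrite mxE lerDl z0.
exists a => //; exists (b - a); last by rewrite addrC subrK.
by move=> i /=; rewrite !mxE subr_ge0.
Qed.

(** The orthant a + N^{Ext(a)}, as a relation between its apex a and its
    points b. *)
Definition anchor n (P : {fset 'rV[int]_n}) (a b : 'rV[int]_n) :=
  forall i, a 0 i <= b 0 i /\ (a 0 i < b 0 i -> i \in Ext P a).

(** The apex is found by maximizing the weight sum_i i a_i over the a <= b in P;
    this linear functional replaces the lexicographic order, since a + e_i - e_j
    with j < i has a larger weight than a. *)
Lemma anchor_exists n (P : {fset 'rV[int]_n}) (b : 'rV[int]_n) :
  upper_shadow P b -> exists2 a, a \in P & anchor P a b.
Proof.
move=> /upper_shadowP[a0 a0P a0b].
pose below (a : P) := [forall i, fsval a 0 i <= b 0 i].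
pose weight (a : P) : int := \sum_(i < n) fsval a 0 i * (i : nat)%:Z.
have below0 : below [` a0P]%fset by apply/forallP.
case: (Order.TotalTheory.arg_maxP weight below0) => -[a aP] /forallP /= ab amax.
exists a => // i; split=> // ai_lt.
rewrite inE; apply/existsPn => j; apply/negP => /andP[ji a'P].
have ij : (i == j) = false by apply/negbTE; rewrite -val_eqE gtn_eqF.
have a'E k : (a + evec n i.+1 - evec n j.+1) 0 k
    = a 0 k + ((k == i)%:R - (k == j)%:R).
  by rewrite !mxE !eqSS addrA.
have /amax : below [` a'P]%fset.
  apply/forallP => k; rewrite [fsval _]/= a'E.
  have := ab k; case: (eqVneq k i) => [->|_]; last first.
    by rewrite sub0r; case: (k == j); rewrite ?subr0 //;
       apply: le_trans; rewrite gerDl.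
  by move: ai_lt; rewrite ij mulr1n; move: (a 0 i) (b 0 i) => p q; lia.
rewrite /= /weight leNgt => /negP; apply.
(* The weights of a + e_i - e_j and a differ by i - j. *)
rewrite -subr_gt0 -sumrB.
under eq_bigr => k _ do rewrite [fsval _]/= a'E [fsval _]/= -mulrBl addrC addKr.
under eq_bigr => k _ do rewrite mulrBl.
rewrite sumrB.
rewrite (bigD1 i) //= eqxx mul1r big1 => [|k /negbTE->]; last by rewrite mul0r.
rewrite (bigD1 j) //= eqxx mul1r big1 => [|k /negbTE->]; last by rewrite mul0r.
by rewrite !addr0 subr_gt0 ltz_nat.
Qed.

Section Polymatroid.
Variables (n : nat) (P : {fset 'rV[int]_n}).
Hypothesis hP : polymatroid P.

(** Suppose v_j < u_j at the first index j where two apexes differ.  Exchange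
    gives an i with u_i < v_i <= b_i and u - e_j + e_i in P.  Then j < i, so
    i is not externally active at u although b leaves u in direction i. *)
Lemma anchor_unique (a a' b : 'rV[int]_n) :
  a \in P -> a' \in P -> anchor P a b -> anchor P a' b -> a = a'.
Proof.
suff no_drop (u v : 'rV[int]_n) (j : 'I_n) : u \in P -> v \in P ->
    anchor P u b -> anchor P v b ->
    (forall k : 'I_n, (k < j)%N -> u 0 k = v 0 k) -> ~~ (v 0 j < u 0 j).
  move=> aP a'P ab a'b; apply/rowP => j.
  have [m] := ubnP (nat_of_ord j); elim: m j => // m IH j /ltnSE jm.
  have eq_before (k : 'I_n) : (k < j)%N -> a 0 k = a' 0 k.
    by move=> kj; apply: IH; apply: leq_trans jm.
  apply/eqP; rewrite eq_le !leNgt no_drop // ?no_drop // => k /eq_before->//.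
move=> uP vP ub vb eq_before; apply/negP => vuj.
have [i [uvi u'P _]] := hP.2 u v uP vP j vuj.
have ji : (j < i)%N.
  rewrite ltnNge leq_eqVlt; apply/negP => /orP[/eqP/val_inj ij|/eq_before uvE].
    by rewrite ij ltNge ltW in uvi.
  by rewrite uvE ltxx in uvi.
have [vib _] := vb i; have [_ /(_ (lt_le_trans uvi vib))] := ub i.
rewrite inE => /existsPn/(_ j); rewrite ji /=.
by rewrite addrAC u'P.
Qed.

(** If b_i > a_i, then b - e_i still dominates a.  If b_i = a_i and some a' in P
    lies below b - e_i + e_j with j < i (or j = 0), exchange i between a and a'
    for some k.  Either k < i, which disproves internal activity of i, or k > i;
    in that case a_k < a'_k <= b_k puts k in Ext(a), which a - e_i + e_k in P
    contradicts. *)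
Lemma tInt_anchor (a b : 'rV[int]_n) : a \in P -> anchor P a b ->
  tInt (upper_shadow P) b = [set i in Int P a | b 0 i == a 0 i].
Proof.
move=> aP ab; have ab_le i := (ab i).1.
have upE (c : 'rV[int]_n) : (c \in upper_shadow P) <->
    exists2 a, a \in P & forall i, a 0 i <= c 0 i.
  by rewrite in_setE upper_shadowP.
apply/setP => i; rewrite !inE; apply/idP/idP.
- move=> /existsPn notS; apply/andP; split; last first.
    apply: contraT => ne; case/negP: (notS ord0); apply/upE; exists a => // k.
    rewrite evec0 addr0; have := ab_le k.
    have -> : (b - evec n i.+1) 0 k = b 0 k - (k == i)%:R by rewrite !mxE eqSS.
    case: eqVneq => [->|_]; last by rewrite subr0.
    by move: ne; rewrite mulr1n; move: (a 0 i) (b 0 i) => p q; lia.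
  apply/existsPn => j; apply/negP => /andP[ji a'P].
  (* The index j of 'I_n is the vector number j + 1 in [evec]. *)
  case/negP: (notS (Ordinal (ji : j.+1 < i.+1)%N)); apply/upE.
  exists (a - evec n i.+1 + evec n j.+1) => // k.
  by rewrite !mxE lerD2r lerD2r.
- move=> /andP[/existsPn iInt /eqP bi]; apply/existsPn => j.
  apply/negP => /upE[a' a'P a'b].
  have a'bk (k : 'I_n) : (i <= k)%N -> a' 0 k <= b 0 k - (k == i)%:R.
    move=> ik; have := a'b k; rewrite !mxE !eqSS.
    rewrite (_ : (k.+1 == j :> nat) = false) ?addr0 //.
    by apply/negbTE; rewrite gtn_eqF // (leq_trans (ltn_ord j)).
  have a'i : a' 0 i < a 0 i.
    have := a'bk i (leqnn i); rewrite eqxx bi.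
    by move: (a 0 i) (a' 0 i) => p q; lia.
  have [k [aka' a1P _]] := hP.2 a a' aP a'P i a'i.
  have [ki|ik] := ltnP k i; first by move: (iInt k); rewrite ki a1P.
  have ne_ki : (k == i) = false.
    by apply/eqP => ki; move: aka'; rewrite ki ltNge ltW.
  have := a'bk k ik; rewrite ne_ki subr0 => a'k.
  have [_ /(_ (lt_le_trans aka' a'k))] := ab k.
  rewrite inE => /existsPn/(_ i); rewrite addrAC a1P andbT.
  by rewrite ltn_neqAle ik andbT val_eqE eq_sym ne_ki.
Qed.

End Polymatroid.

(** * Formal power series *)

Section Series.
Variable R : comNzRingType.
Implicit Types (f g : fps R) (c : R).

Lemma coef_fps_sum (I : Type) (r : seq I) (Q : pred I) (F : I -> fps R) k :
  (\sum_(i <- r | Q i) F i) k = \sum_(i <- r | Q i) F i k.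
Proof. by elim/big_rec2: _ => // i x f _ <-. Qed.

Fact fpsC_is_zmod_morphism : zmod_morphism (@fpsC R).
Proof. by move=> a b; apply: fpsP => -[|k] //=; rewrite subr0. Qed.

Lemma coef_fpsCM c f k : (fpsC c * f) k = c * f k.
Proof.
rewrite coef_fpsM big_ord_recl subn0 big1 ?addr0 // => i _.
by rewrite /= mul0r.
Qed.

Fact fpsC_is_monoid_morphism : monoid_morphism (@fpsC R).
Proof.
split=> // a b; apply: fpsP => k; rewrite coef_fpsCM /=.
by case: eqP => // _; rewrite mulr0.
Qed.

HB.instance Definition _ := GRing.isZmodMorphism.Build R (fps R) (@fpsC R)
  fpsC_is_zmod_morphism.
HB.instance Definition _ := GRing.isMonoidMorphism.Build R (fps R) (@fpsC R)
  fpsC_is_monoid_morphism.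

Lemma fps_mul_low f g m l : (forall k, (k < m)%N -> f k = 0) ->
  (forall k, (k < l)%N -> g k = 0) ->
  (forall k, (k < m + l)%N -> (f * g) k = 0) /\ (f * g) (m + l)%N = f m * g l.
Proof.
move=> f0 g0; split=> [k kml|].
  rewrite coef_fpsM big1 // => i _; have [im|mi] := ltnP i m.
    by rewrite f0 // mul0r.
  by rewrite g0 ?mulr0 //; have := ltn_ord i; lia.
rewrite coef_fpsM; have mlt : (m < (m + l).+1)%N by lia.
rewrite (bigD1 (Ordinal mlt)) //= addKn big1 ?addr0 // => i ne.
have [im|mi] := ltnP i m; first by rewrite f0 // mul0r.
have ne' : (i : nat) != m by [].
rewrite g0 ?mulr0 //; have := ltn_ord i; move: ne' mi. lia.
Qed.

Lemma fps_exp_low f j : f 0%N = 0 ->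
  (forall k, (k < j)%N -> (f ^+ j) k = 0) /\ (f ^+ j) j = f 1%N ^+ j.
Proof.
move=> f0; elim: j => [|j [IH0 IHj]].
  by split; rewrite // expr0 coef_fps1.
have [//|lo top] := @fps_mul_low f (f ^+ j) 1 j _ IH0; first by case.
by rewrite exprS; split=> //; rewrite top IHj exprS.
Qed.

Lemma coef_fpsXn m k : (fpsX ^+ m : fps R) k = (k == m)%:R.
Proof.
elim: m k => [|m IH] k; first by rewrite coef_fps1.
rewrite exprSr coef_fpsM; case: k => [|k].
  by rewrite big_ord1 /= mulr0.
rewrite big_ord_recr /= subnn mulr0 addr0 big_ord_recr /= IH subSnn eqxx mulr1.
rewrite big1 ?add0r ?eqSS // => i _ /=.
rewrite (_ : (k.+1 - i == 1)%N = false) ?mulr0 //.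
by have := ltn_ord i; lia.
Qed.

(** Strong induction on k: once the coefficients of p below k vanish, the
    coefficient of order k of p(f) is p_k, as f^k starts with the term of
    order k and the later powers of f start beyond it. *)
Lemma fps_horner_eq0 f (p : {poly R}) : f 0%N = 0 -> f 1%N = 1 ->
  (map_poly (@fpsC R) p).[f] = 0 -> p = 0.
Proof.
move=> f0 f1 pf0; apply/polyP => k; rewrite coef0.
have [m] := ubnP k; elim: m k => // m IH k /ltnSE km.
have [sk|ks] := leqP (size p) k; first by rewrite nth_default.
have := congr1 (fun g : fps R => g k) pf0.
rewrite (@horner_coef_wide _ (size p)); last by rewrite size_poly.
rewrite coef_fps_sum (bigD1 (Ordinal ks)) // big1 => [|i ne].
  rewrite coef_map coef_fpsCM.
  by rewrite (fps_exp_low _ _).2 // f1 expr1n mulr1 /= addr0.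
rewrite coef_map coef_fpsCM; have [ik|ki] := ltnP i k.
  by rewrite IH ?mul0r //; apply: leq_trans km.
rewrite (fps_exp_low _ _).1 ?mulr0 // ltn_neqAle ki andbT.
by move: ne; rewrite -val_eqE eq_sym.
Qed.

(** The shift p(1 + T) reduces this to the series t = 1/(1-v) - 1 of order 1. *)
Lemma fps_horner_geom_inj (p : {poly R}) :
  (map_poly (@fpsC R) p).[(1 - fpsX)^-1] = 0 -> p = 0.
Proof.
move=> py0; suff shift0 : p \Po ('X + 1%:P) = 0.
  have <- : p \Po ('X + 1%:P) \Po ('X - 1%:P) = p.
    by rewrite -comp_polyA comp_polyD comp_polyX comp_polyC subrK comp_polyXr.
  by rewrite shift0 comp_poly0.
pose t : fps R := (1 - fpsX)^-1 - 1.
apply: (@fps_horner_eq0 t).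
- by rewrite coef_fpsD coef_fpsN coef_fps1BXV coef_fps1 subrr.
- by rewrite coef_fpsD coef_fpsN coef_fps1BXV coef_fps1 subr0.
rewrite map_comp_poly horner_comp rmorphD /= map_polyX map_polyC /= rmorph1.
by rewrite !hornerE subrK.
Qed.

(** Only the coefficients of order at most k matter, so each factor may be
    replaced by its truncation, a finite sum of monomials; then the product is
    expanded by distributivity. *)
Lemma coef_fps_prod n (F : 'I_n -> fps R) k :
  (\prod_i F i) k =
  \sum_(c : {ffun 'I_n -> 'I_k.+1} | (\sum_i c i == k)%N) \prod_i F i (c i).
Proof.
pose G i : fps R := \sum_(m < k.+1) fpsC (F i m) * fpsX ^+ m.
have FG i m : (m <= k)%N -> F i m = G i m.
  move=> mk; rewrite coef_fps_sum (bigD1 (inord m)) // coef_fpsCM inordK //.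
  rewrite coef_fpsXn eqxx mulr1 big1 => [|j ne]; first by rewrite /= addr0.
  rewrite coef_fpsCM coef_fpsXn; case: eqP => [mj|_]; last by rewrite /= mulr0.
  by rewrite mj inord_val eqxx in ne.
transitivity ((\prod_i G i) k).
  suff H m : (m <= k)%N -> (\prod_i F i) m = (\prod_i G i) m by apply: H.
  move: m; elim/big_rec2: _ => // i f g _ IH m mk; rewrite !coef_fpsM.
  apply: eq_bigr => j _; rewrite FG ?IH //;
    last exact: leq_trans (leq_ord j) mk.
  exact: leq_trans (leq_subr _ _) mk.
rewrite /G bigA_distr_bigA /= coef_fps_sum [RHS]big_mkcond /=.
apply: eq_bigr => c _.
have -> : \prod_i (fpsC (F i (c i)) * fpsX ^+ c i) =
    fpsC (\prod_i F i (c i)) * fpsX ^+ (\sum_i c i)%N.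
  by rewrite big_split /= rmorph_prod prodrXr.
by rewrite coef_fpsCM coef_fpsXn eq_sym; case: eqP; rewrite ?mulr1 ?mulr0.
Qed.

End Series.

(** * Evaluation of the Tutte polynomial *)

Section Evaluation.
Variable A : comNzRingType.
Implicit Types (x y : A) (p : {poly {poly int}}).

(** The values are those of [eval2]; this form displays the ring morphism. *)
Definition eval2_rmorphism x y : {rmorphism {poly {poly int}} -> A} :=
  horner_eval x \o map_poly (horner_eval y \o map_poly intr).

Lemma eval2E x y p : eval2 p x y = eval2_rmorphism x y p.
Proof. by []. Qed.

Lemma eval2D x y : {morph (fun p => eval2 p x y) : p q / p + q}.
Proof. by move=> p q; rewrite !eval2E rmorphD. Qed.

Lemma eval2M x y : {morph (fun p => eval2 p x y) : p q / p * q}.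
Proof. by move=> p q; rewrite !eval2E rmorphM. Qed.

Lemma eval2_X x y : eval2 'X x y = x.
Proof. by rewrite eval2E /= map_polyX /horner_eval hornerX. Qed.

Lemma eval2_C x y (c : {poly int}) : eval2 c%:P x y = (map_poly intr c).[y].
Proof. by rewrite eval2E /= map_polyC /= /horner_eval hornerC. Qed.

Lemma eval2_Y x y : eval2 'X%:P x y = y.
Proof. by rewrite eval2_C map_polyX hornerX. Qed.

Lemma eval2_swapXY x y p : eval2 (swapXY p) x y = eval2 p y x.
Proof.
elim/poly_ind: p => [|p c IH]; first by rewrite !eval2E !rmorph0.
rewrite (rmorphD swapXY) (rmorphM swapXY) /= swapXY_X swapXY_polyC.
rewrite !eval2D !eval2M IH eval2_X eval2_Y; congr (_ + _).
elim/poly_ind: c => [|c a IHc]; first by rewrite !eval2E !rmorph0.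
rewrite (rmorphD (map_poly polyC)) (rmorphM (map_poly polyC)) /=.
rewrite map_polyX map_polyC.
rewrite rmorphD rmorphM !eval2D !eval2M IHc eval2_X eval2_Y; congr (_ + _).
by rewrite !eval2_C !map_polyC !hornerC.
Qed.

Lemma eval2_tutte n (P : {fset 'rV[int]_n}) x y :
  eval2 (tutte P) x y =
  \sum_(a <- P) x ^+ #|Int P a :\: Ext P a| * y ^+ #|Ext P a :\: Int P a|
                * (x + y - 1) ^+ #|Int P a :&: Ext P a|.
Proof.
rewrite eval2E rmorph_sum; apply: eq_bigr => a _.
by rewrite !rmorphM !rmorphXn rmorphB rmorphD rmorph1 -!eval2E eval2_X eval2_Y.
Qed.

End Evaluation.

Lemma horner_fpsCX (c : {poly int}) :
  (map_poly intr c).[fpsC ('X : {poly int})] = fpsC c.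
Proof.
elim/poly_ind: c => [|c a IH]; first by rewrite !rmorph0 horner0.
rewrite !(rmorphD, rmorphM) /= map_polyX map_polyC !hornerE IH.
by rewrite -[a in RHS]intz !rmorph_int.
Qed.

(** Evaluation at (1/(1-v), x) is evaluation at 1/(1-v) of a polynomial whose
    coefficients are the constant series c(x), so that
    [fps_horner_geom_inj] applies over Z[x]. *)
Lemma eval2_geomC_inj (p q : {poly {poly int}}) :
  let y : fps {poly int} := (1 - fpsX)^-1 in
  eval2 p y (fpsC 'X) = eval2 q y (fpsC 'X) -> p = q.
Proof.
move=> y pq; apply/eqP; rewrite -subr_eq0; apply/eqP.
apply: fps_horner_geom_inj; have: eval2 (p - q) y (fpsC 'X) = 0.
  by rewrite eval2E rmorphB -!eval2E pq subrr.
move=> <-; rewrite /eval2; congr _.[_]; apply: eq_map_poly => c.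
by rewrite horner_fpsCX.
Qed.

(** * Reflection of a polymatroid through the origin *)

Section Reflection.
Variables (n : nat) (P : {fset 'rV[int]_n}).

Definition reflect_fset : {fset 'rV[int]_n} := [fset - a | a in P]%fset.
Local Notation P' := reflect_fset.

Lemma mem_reflect a : (a \in P') = (- a \in P).
Proof.
apply/imfsetP/idP => /= [[b bP ->]|aP]; first by rewrite opprK.
by exists (- a); rewrite ?opprK.
Qed.

Lemma polymatroid_reflect : polymatroid P -> polymatroid P'.
Proof.
case=> /fset0Pn[a0 a0P] exch; split.
  by apply/fset0Pn; exists (- a0); rewrite mem_reflect opprK.
move=> a b; rewrite !mem_reflect => aP bP i ba.
have [|j [abj b'P a'P]] := exch _ _ bP aP i; first by rewrite !mxE ltrN2.
exists j; split; first by move: abj; rewrite !mxE ltrN2.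
  by rewrite mem_reflect !opprD !opprK.
by rewrite mem_reflect !opprD !opprK.
Qed.

Lemma Int_reflect a : Int P' (- a) = Ext P a.
Proof.
apply/setP => i; rewrite !inE; congr (~~ _); apply: eq_existsb => j.
by rewrite mem_reflect !opprD !opprK.
Qed.

Lemma Ext_reflect a : Ext P' (- a) = Int P a.
Proof.
apply/setP => i; rewrite !inE; congr (~~ _); apply: eq_existsb => j.
by rewrite mem_reflect !opprD !opprK.
Qed.

Lemma upper_shadow_reflect a : upper_shadow P' (- a) <-> lower_shadow P a.
Proof.
split=> [/upper_shadowP[b]|[b bP [z z0 <-]]].
  rewrite mem_reflect => bP ab; exists (- b) => //; exists (a + b).
    by move=> i; have := ab i; rewrite !mxE lerNr -subr_le0 opprK.
  by rewrite addrCA addNr addr0.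
apply/upper_shadowP; exists (- b); first by rewrite mem_reflect opprK.
by move=> i; rewrite !mxE lerN2 gerDl z0.
Qed.

Lemma tInt_reflect a : tInt (upper_shadow P') (- a) = tExt (lower_shadow P) a.
Proof.
apply/setP => i; rewrite !inE; congr (~~ _); apply: eq_existsb => j.
apply/idP/idP; rewrite !in_setE -upper_shadow_reflect !opprD !opprK //.
Qed.

Lemma plevel_reflect : polymatroid P -> plevel P' = - plevel P.
Proof.
move=> hP; have [a aP] : exists a, a \in P by apply/fset0Pn; case: hP.
have naP : - a \in P' by rewrite mem_reflect opprK.
rewrite -(polymatroid_level hP aP) -levelN.
by rewrite (polymatroid_level (polymatroid_reflect hP) naP).
Qed.

Lemma big_reflect (V : zmodType) (F : 'rV[int]_n -> V) :
  \sum_(a <- P') F a = \sum_(a <- P) F (- a).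
Proof. by rewrite big_imfset //= => a b _ _; apply: oppr_inj. Qed.

(** Reflection exchanges internal and external activity, hence x and y. *)
Lemma eval2_tutte_reflect (A : comNzRingType) (x y : A) :
  eval2 (tutte P') x y = eval2 (tutte P) y x.
Proof.
rewrite !eval2_tutte big_reflect; apply: eq_bigr => a _.
by rewrite Int_reflect Ext_reflect finset.setIC (addrC x) (mulrC (x ^+ _)).
Qed.

End Reflection.

(** * The two expansions *)

Lemma activity_prod (R : comNzRingType) n (I E : {set 'I_n}) (x y z : R) :
  x ^+ #|I :\: E| * y ^+ #|E :\: I| * z ^+ #|I :&: E| =
  \prod_i (if i \in I then if i \in E then z else x
           else if i \in E then y else 1).
Proof.
rewrite -!prodr_const (big_mkcond [in I :\: E]) (big_mkcond [in E :\: I]).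
rewrite (big_mkcond [in I :&: E]) -!big_split /=; apply: eq_bigr => i _.
by rewrite !inE; case: (i \in I); case: (i \in E); rewrite ?mulr1 ?mul1r.
Qed.

(** The sum runs over the points at height k of the orthant N^E, each weighted
    by the coordinates in I that it leaves equal to 0.  Coordinates up to k
    suffice, whence the finite range of c. *)
Lemma coef_activity (R : comNzRingType) n (I E : {set 'I_n}) (x : R) k :
  let y : fps R := (1 - fpsX)^-1 in
  (fpsC x ^+ #|I :\: E| * y ^+ #|E :\: I| * (fpsC x + y - 1) ^+ #|I :&: E|) k =
  \sum_(c : {ffun 'I_n -> 'I_k.+1} |
        (\sum_i c i == k)%N && [forall i, (c i != 0 :> nat) ==> (i \in E)])
     x ^+ #|[set i in I | c i == 0 :> nat]|.
Proof.
move=> y; rewrite activity_prod coef_fps_prod.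
rewrite [LHS]big_mkcond [RHS]big_mkcond /=; apply: eq_bigr => c _.
case: ifP => //= _.
have cE i : (if i \in I then if i \in E then fpsC x + y - 1 else fpsC x
             else if i \in E then y else 1) (c i) =
    if (c i == 0 :> nat) then if i \in I then x else 1 else (i \in E)%:R.
  have yE m : y m = 1 by exact: coef_fps1BXV.
  case: (i \in I); case: (i \in E);
    rewrite ?coef_fpsD ?coef_fpsN ?yE ?coef_fps1 /=; case: eqP => _ //=;
    by rewrite ?addrK ?add0r ?subr0.
under eq_bigr => i _ do rewrite cE.
case: ifP => [/forallP cov|/negbT/forallPn[i]]; last first.
  rewrite negb_imply => /andP[ci iE].
  by rewrite (bigD1 i) //= (negbTE ci) (negbTE iE) mul0r.
rewrite -prodr_const [RHS]big_mkcond; apply: eq_bigr => i _.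
rewrite inE; have := cov i; case: eqP => /= _; first by rewrite andbT.
by move=> ->; rewrite andbF.
Qed.

Section Expansion.
Variables (n : nat) (P : {fset 'rV[int]_n}).
Hypothesis hP : polymatroid P.

Definition translate k (p : 'rV[int]_n * {ffun 'I_n -> 'I_k.+1}) : 'rV[int]_n :=
  p.1 + \row_i (p.2 i : nat)%:Z.

Definition in_orthant k (p : 'rV[int]_n * {ffun 'I_n -> 'I_k.+1}) : bool :=
  (\sum_i p.2 i == k)%N &&
  [forall i, (p.2 i != 0 :> nat) ==> (i \in Ext P p.1)].

(** An explicit enumeration of the points of the upper shadow at height k above
    P, through the tiling: [translate] maps it bijectively to them. *)
Definition shadow_slice k :
  seq ('rV[int]_n * {ffun 'I_n -> 'I_k.+1}) :=
  [seq p <- [seq (a, c) | a <- enum_fset P,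
                          c <- index_enum {ffun 'I_n -> 'I_k.+1}]
  | in_orthant p].

Lemma translateE k (p : 'rV[int]_n * {ffun 'I_n -> 'I_k.+1}) i :
  translate p 0 i = p.1 0 i + (p.2 i : nat)%:Z.
Proof. by rewrite !mxE. Qed.

Lemma mem_shadow_slice k p :
  (p \in shadow_slice k) = in_orthant p && (p.1 \in P).
Proof.
rewrite mem_filter; congr (_ && _); case: p => a c /=.
apply/allpairsP/idP => [[q [qP _ [-> _]]] //|aP].
by exists (a, c); split; rewrite ?mem_index_enum.
Qed.

Lemma anchor_translate k p : p \in shadow_slice k -> anchor P p.1 (translate p).
Proof.
rewrite mem_shadow_slice => /andP[/andP[_ /forallP cov] _] i.
rewrite translateE lerDl; split=> //; rewrite ltrDl ltz_nat lt0n => ci.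
by have := cov i; rewrite ci.
Qed.

Lemma translate_inj k : {in shadow_slice k &, injective (@translate k)}.
Proof.
move=> p q pS qS pq.
have pa := anchor_translate pS; have qa := anchor_translate qS.
have pP : p.1 \in P by move: pS; rewrite mem_shadow_slice => /andP[].
have qP : q.1 \in P by move: qS; rewrite mem_shadow_slice => /andP[].
rewrite -pq in qa; have a_eq := anchor_unique hP pP qP pa qa.
case: p q a_eq pq {pS qS pa qa pP qP} => a c [a' c'] /= -> pq; congr pair.
apply/ffunP => i; apply/val_inj; have := congr1 (fun b : 'rV_n => b 0 i) pq.
by rewrite /= !translateE /= => /addrI[].
Qed.

Lemma level_translate k p : p \in shadow_slice k ->
  level (translate p) - plevel P = k.
Proof.
rewrite mem_shadow_slice => /andP[/andP[/eqP ck _] pP].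
rewrite levelD (polymatroid_level hP pP) addrC addKr -[in RHS]ck /level.
by rewrite (big_morph Posz PoszD (erefl _)); apply: eq_bigr => i _; rewrite mxE.
Qed.

Lemma translate_surj k (b : 'rV[int]_n) : upper_shadow P b ->
  level b - plevel P = k%:Z ->
  exists2 p, p \in shadow_slice k & b = translate p.
Proof.
move=> bS bk; have [a aP ab] := anchor_exists bS.
pose d (i : 'I_n) := absz (b 0%R i - a 0%R i)%R.
have Dba i : (d i)%:Z = b 0 i - a 0 i.
  by rewrite /d gez0_abs // subr_ge0; case: (ab i).
have sumk : (\sum_i d i = k)%N.
  apply: (congr1 absz (_ : _%:Z = k%:Z)).
  rewrite -bk -(polymatroid_level hP aP) -levelN -levelD.
  rewrite (big_morph Posz PoszD (erefl _)).
  by apply: eq_bigr => i _; rewrite Dba !mxE.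
pose c : {ffun 'I_n -> 'I_k.+1} := [ffun i => inord (d i)].
have cE i : c i = d i :> nat.
  by rewrite ffunE inordK // ltnS -sumk (bigD1 i) //= leq_addr.
exists (a, c); last first.
  by apply/rowP => i; rewrite translateE /= cE Dba addrC subrK.
rewrite mem_shadow_slice aP andbT; apply/andP; split=> /=.
  by rewrite -[X in _ == X]sumk; apply/eqP/eq_bigr => i _; rewrite cE.
apply/forallP => i; apply/implyP; rewrite /= cE => ci.
apply: (ab i).2; rewrite lt_neqAle (ab i).1 andbT.
by move: ci; rewrite /d absz_eq0 subr_eq0 eq_sym.
Qed.

Lemma upper_expansion :
  let x : fps {poly int} := fpsC 'X in
  let y : fps {poly int} := (1 - fpsX)^-1 in
  fps_has_sum (upper_shadow P)
    (fun a => x ^+ #|tInt (upper_shadow P) a| *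
              fpsX ^+ `|level a - plevel P|%N)
    (eval2 (tutte P) x y).
Proof.
move=> x y k; set S := upper_shadow P; rewrite eval2_tutte.
pose F a : fps {poly int} := x ^+ #|tInt S a| * fpsX ^+ `|level a - plevel P|%N.
have FE a : F a k = if k == `|level a - plevel P|%N then 'X^#|tInt S a| else 0.
  rewrite /F /x -rmorphXn coef_fpsCM coef_fpsXn.
  by case: eqP => _; rewrite ?mulr1 ?mulr0.
(* All terms of order k come from the finite list r. *)
pose r := [seq translate p | p <- shadow_slice k].
have r_uniq : uniq r.
  rewrite (map_inj_in_uniq (@translate_inj k)) filter_uniq //.
  by rewrite allpairs_uniq ?index_enum_uniq ?fset_uniq // => -[? ?] [? ?].
have memr a : S a -> F a k != 0 -> a \in r.
  move=> aS; rewrite FE; case: ifP => [/eqP ka _|_ /eqP //].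
  have [|p pS ->] := translate_surj aS (k := k); last exact: map_f.
  by rewrite ka gez0_abs // subr_ge0 upper_shadow_level.
have rS a : a \in r -> S a.
  case/mapP => p pS ->; apply/upper_shadowP; exists p.1.
    by move: pS; rewrite mem_shadow_slice => /andP[].
  by move=> i; case: (anchor_translate pS i).
split; first by apply: sub_finite_set (finite_seq r) => a [aS Fa]; exact: memr.
rewrite -(@fsbig_widen _ _ _ _ [set` r]%classic S (fun a => F a k));
  first 1 last.
- by move=> a /rS.
- move=> a [aS anr]; apply/eqP; apply: contra_notT anr; exact: memr.
rewrite -fsbig_seq // big_map big_filter.
rewrite [RHS]big_mkcond [RHS]big_allpairs coef_fps_sum.
rewrite big_seq [RHS]big_seq; apply: eq_bigr => a aP.
rewrite coef_activity -[RHS]big_mkcond; apply: eq_big => // c cond.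
have pS : (a, c) \in shadow_slice k.
  by rewrite mem_shadow_slice /in_orthant /= cond.
rewrite FE level_translate // eqxx (tInt_anchor hP aP (anchor_translate pS)).
congr ('X ^+ #|pred_of_set _|); apply/setP => i; rewrite !inE translateE /=.
by congr (_ && _); rewrite -[in RHS]subr_eq0 addrC addKr.
Qed.

End Expansion.

(** The upper expansion of -P, transported along a |-> - a. *)
Lemma lower_expansion n (P : {fset 'rV[int]_n}) : polymatroid P ->
  let x : fps {poly int} := (1 - fpsX)^-1 in
  let y : fps {poly int} := fpsC 'X in
  fps_has_sum (lower_shadow P)
    (fun a => fpsX ^+ `|plevel P - level a|%N * y ^+ #|tExt (lower_shadow P) a|)
    (eval2 (tutte P) x y).
Proof.
move=> hP x y; set P' := reflect_fset P.
rewrite -eval2_tutte_reflect -/P' => k.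
have [fin sum] := upper_expansion (polymatroid_reflect hP) k.
have bij_opp (S S' : set 'rV[int]_n) : (forall a, S' (- a) <-> S a) ->
    set_bij S S' (-%R).
  move=> SS'; split=> [a /SS' //|a b _ _|a S'a]; first exact: oppr_inj.
  by exists (- a); rewrite ?opprK // -SS' opprK.
pose F a : fps {poly int} :=
  fpsC 'X ^+ #|tInt (upper_shadow P') a| * fpsX ^+ `|level a - plevel P'|%N.
have FE a : F (- a) =
    fpsX ^+ `|plevel P - level a|%N * y ^+ #|tExt (lower_shadow P) a|.
  by rewrite /F tInt_reflect levelN plevel_reflect // opprK addrC mulrC.
split.
  rewrite (_ : [set a | _] =
      -%R @` [set a | upper_shadow P' a /\ F a k != 0])%classic.
    exact: finite_image.
  apply/seteqP; split=> a.
    move=> [aS Fa]; exists (- a); last exact: opprK.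
    by split; [apply/upper_shadow_reflect|rewrite FE].
  move=> [b [bS Fb] <-]; split.
    by apply/upper_shadow_reflect; rewrite opprK.
  by move: Fb; rewrite -{1}[b]opprK FE.
transitivity (\sum_(a \in upper_shadow P') F a k); last first.
  rewrite (reindex_fsbig _ _ _ _ (bij_opp _ _ (upper_shadow_reflect P))).
  by apply: eq_fsbigr => a _; rewrite FE.
exact: sum.
Qed.

Theorem theorem11p5 (n : nat) (P : {fset 'rV[int]_n}) (hP : polymatroid P) :
  let upper_formula (T : {poly {poly int}}) :=
    let x := fpsC ('X : {poly int}) in
    let v := fpsX : fps {poly int} in
    let S := upper_shadow P in
    fps_has_sum S
      (fun a => x ^+ #|tInt S a| * v ^+ `|level a - plevel P|%N)
      (eval2 T x (1 - v)^-1) in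
  let lower_formula (T : {poly {poly int}}) :=
    let u := fpsX : fps {poly int} in
    let y := fpsC ('X : {poly int}) in
    let S := lower_shadow P in
    fps_has_sum S
      (fun a => u ^+ `|plevel P - level a|%N * y ^+ #|tExt S a|)
      (eval2 T (1 - u)^-1 y) in
  [/\ upper_formula (tutte P),
      lower_formula (tutte P),
      forall T, upper_formula T -> T = tutte P
    & forall T, lower_formula T -> T = tutte P].
Proof.
move=> upper_formula lower_formula.
have upper : upper_formula (tutte P).
  exact: upper_expansion.
have lower : lower_formula (tutte P).
  exact: lower_expansion.
split=> // T hT.
  (* In the first formula the series replaces y, the inner variable. *)
  apply: (can_inj swapXYK); apply: eval2_geomC_inj; rewrite !eval2_swapXY.
  by apply: fpsP => k; rewrite (hT k).2 (upper k).2.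
apply: eval2_geomC_inj.
by apply: fpsP => k; rewrite (hT k).2 (lower k).2.
Qed.
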